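(* Let $\lambda\in\mathbb{R}^+$ and let $G$ be a 5-dimensional Riemannian Lie group with Lie algebra $\mathfrak{g}$, carrying a left-invariant, minimal and conformal distribution $\mathcal{V}$ generated by the Riemannian subalgebra $\mathfrak{sl}_2(\mathbb R)$ of $\mathfrak{g}$, i.e. $\mathcal V=\mathrm{span}\{X,Y,Z\}$ where $\{X,Y,Z,A,B\}$ is an adapted orthonormal basis of $\mathfrak g$ (see context) and $$[X,Y]=2\lambda Z,\quad [Z,X]=2\lambda Y,\quad [Y,Z]=-\tfrac{2}{\lambda}X .$$ Then the Lie bracket relations of $\mathfrak g$ are of the form $$[X,Y]=2\lambda Z,\quad [Z,X]=2\lambda Y,\quad [Y,Z]=-\tfrac{2}{\lambda}X,$$ \begin{align*} [X,A]&=\lambda^2x_3Y+\lambda^2x_5Z, & [X,B]&=\lambda^2x_4Y+\lambda^2x_6Z,\\ [Y,A]&=x_3X+z_3Z, & [Y,B]&=x_4X+z_4Z,\\ [Z,A]&=x_5X-z_3Y, & [Z,B]&=x_6X-z_4Y,\\ [A,B]&=rA+\theta_1X+\theta_2Y+\theta_3Z, \end{align*} with $r,x_3,x_4,x_5,x_6,z_3,z_4\in\mathbb R$, where $\theta_1,\theta_2,\theta_3$ are given by $$\begin{pmatrix}\theta_1\\ \theta_2\\ \theta_3\end{pmatrix}=\frac12\begin{pmatrix} rz_3/\lambda-\lambda(x_3x_6-x_4x_5)\\ -\lambda(rx_5-x_3z_4+x_4z_3)\\ \lambda(rx_3+z_4x_5-z_3x_6)\end{pmatrix}.$$ The corresponding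 foliation $\mathcal F$ tangent to $\mathcal V$ is Riemannian but not totally geodesic for any values of $\lambda\in\mathbb R^+$.
   Context: A Riemannian Lie group is a Lie group $G$ equipped with a left-invariant Riemannian metric $g=\langle\cdot,\cdot\rangle$; this is an inner product on its Lie algebra $\mathfrak g$. A left-invariant distribution $\mathcal V$ is identified with a subspace of $\mathfrak g$; it is integrable iff this subspace is a subalgebra $\mathfrak k$. $\mathcal H=\mathcal V^\perp$ is the orthogonal complement; $\mathcal V,\mathcal H$ also denote the orthogonal projections; $\nabla$ is the Levi-Civita connection. Set $B^{\mathcal V}(U,V)=\frac12\mathcal H(\nabla_UV+\nabla_VU)$ for $U,V\in\mathcal V$ and $B^{\mathcal H}(E,F)=\frac12\mathcal V(\nabla_EF+\nabla_FE)$ for $E,F\in\mathcal H$. The integrable distribution $\mathcal V$ (equivalently the foliation $\mathcal F$ tangent to it) is conformal if there is a vector field $V\in\mathcal V$ with $B^{\mathcal H}=g\otimes V$; Riemannian if this holds with $V=0$; minimal if $\mathrm{trace}\,B^{\mathcal V}=0$; totally geodesic if $B^{\mathcal V}=0$. Adapted orthonormal basis: $\mathcal V$ is a 3-dimensional integrable, conformal, minimal left-invariant distribution on the 5-dimensional $G$, $\{X,Y,Z,A,B\}$ is an orthonormal basis of $\mathfrak g$ with $\mathcal V=\mathrm{span}\{X,Y,Z\}$ and $\mathcal H=\mathrm{span}\{A,B\}$, and $A,B$ are chosen (as is always possible) such that the $\mathcal H$-component of $[A,B]$ is a multiple of $A$, that is, $[A,B]=rA+\theta_1X+\theta_2Y+\theta_3Z$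 with real constants.
   Formalization: ''Not totally geodesic'' is proved when (x3,x4,x5,x6) is not zero, and for each λ a non-totally-geodesic example is shown to exist; if x3=x4=x5=x6=0 (e.g. the orthogonal product of sl2 with an abelian plane) the foliation is totally geodesic. *)

(* Defs.v *)
From HB Require Import structures.
From mathcomp Require Import all_boot all_order all_algebra.
From mathcomp Require Import boolp reals.
From mathcomp Require Import ring lra.

Set Implicit Arguments.
Unset Strict Implicit.
Unset Printing Implicit Defensive.

Import Order.TTheory GRing.Theory Num.Theory.
Local Open Scope ring_scope.

(* The infinitesimal form of a Lie group with a left-invariant Riemannian
   metric: elements are left-invariant vector fields, and subspaces are
   left-invariant distributions. *)
Record riemLieAlg (R : realType) := RiemLieAlg {
  rla_sort :> vectType R;
  lie : {bilinear rla_sort -> rla_sort -> rla_sort};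
  ip : {dot rla_sort for @idfun R};
  lie_alt : forall u : rla_sort, lie u u = 0;
  lie_jacobi : forall u v w : rla_sort,
    lie u (lie v w) + lie v (lie w u) + lie w (lie u v) = 0
}.

Arguments lie {R r}.
Arguments ip {R r}.

Section LeviCivita.
Variables (R : realType) (g : riemLieAlg R).
Implicit Types (u v w : g) (nabla : {bilinear g -> g -> g}).

Definition torsion_free nabla :=
  forall u v, nabla u v - nabla v u = lie u v.

(* The inner product of two left-invariant fields is a constant function, so
   the term w<u, v> of metric compatibility vanishes. *)
Definition metric_compatible nabla :=
  forall w u v, ip (nabla w u) v + ip u (nabla w v) = 0.

Definition is_levi_civita nabla := torsion_free nabla /\ metric_compatible nabla.

Lemma ipC u v : ip u v = ip v u.
Proof. by rewrite hermC expr0 mul1r. Qed.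

Lemma ipPl a u v w : ip (a *: u + v) w = a * ip u w + ip v w.
Proof. by rewrite linearPl. Qed.

Lemma ipPr a u v w : ip w (a *: u + v) = a * ip w u + ip w v.
Proof. by rewrite linearPr. Qed.

Lemma liePl a u v w : lie (a *: u + v) w = a *: lie u w + lie v w.
Proof. by rewrite linearPl. Qed.

Lemma liePr a u v w : lie w (a *: u + v) = a *: lie w u + lie w v.
Proof. by rewrite linearPr. Qed.

Lemma ip_inj u v : (forall w, ip u w = ip v w) -> u = v.
Proof.
move=> uv; apply/eqP; rewrite -subr_eq0; apply/negP => /negP nz.
have := neq0_dnorm_gt0 (s := ip) _ nz.
by rewrite linearBl /= uv subrr ltxx.
Qed.

Lemma riesz (phi : {linear g -> R^o}) : exists u, forall w, ip u w = phi w.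
Proof.
pose fl u : 'Hom(g, R^o) := linfun (applyr ip u : g -> R^o).
have flE u w : fl u w = ip w u by rewrite lfunE.
have fl_lin : linear fl.
  move=> a u v; apply/lfunP => w; rewrite add_lfunE scale_lfunE !flE.
  by rewrite linearDr linearZr_LR.
pose fM := GRing.isLinear.Build _ _ _ _ fl fl_lin.
pose flL : {linear g -> 'Hom(g, R^o)} := HB.pack fl fM.
pose F := linfun flL.
have FE u : F u = fl u by rewrite lfunE.
have kF : lker F == 0%VS.
  apply/lker0P => u v; rewrite !FE => /lfunP e.
  by apply: ip_inj => w; have := e w; rewrite !flE ![ip w _]ipC.
have imF : limg F = fullv.
  apply/eqP; rewrite eqEdim subvf limg_dim_eq ?(eqP kF) ?capv0 //.
  by rewrite !dimvf /dim /= muln1.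
have : linfun phi \in limg F by rewrite imF memvf.
case/memv_imgP => u _ /lfunP e; exists u => w.
by have := e w; rewrite FE flE lfunE /= ipC.
Qed.

Definition koszul u v w : R :=
  2^-1 * (ip (lie u v) w - ip (lie v w) u + ip (lie w u) v).

Lemma lieC u v : lie u v = - lie v u.
Proof.
apply/eqP; rewrite -addr_eq0.
have := lie_alt (u + v).
by rewrite linearDl /= !linearDr /= !lie_alt add0r addr0 => ->.
Qed.

Lemma levi_civita_koszul nabla : is_levi_civita nabla ->
  forall u v w, ip (nabla u v) w = koszul u v w.
Proof.
move=> [tf mc] u v w; rewrite /koszul -!tf !linearBl /=.
have := (mc u v w, mc v w u, mc w u v) => -[[]].
rewrite [ip v _]ipC [ip w _]ipC [ip u _]ipC; lra.
Qed.

Lemma levi_civita_unique nabla nabla' :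
  is_levi_civita nabla -> is_levi_civita nabla' -> nabla =2 nabla'.
Proof.
move=> /levi_civita_koszul h /levi_civita_koszul h' u v.
by apply: ip_inj => w; rewrite h h'.
Qed.

Lemma levi_civita_exists : exists nabla, is_levi_civita nabla.
Proof.
have ex u v : exists x, forall w, ip x w = koszul u v w.
  have lin0 a x y : koszul u v (a *: x + y) = a * koszul u v x + koszul u v y.
    by rewrite /koszul !(liePl, liePr, ipPl, ipPr); ring.
  have lin : linear (koszul u v : g -> R^o) by exact: lin0.
  pose kM := GRing.isLinear.Build _ _ _ _ _ lin.
  pose k : {linear g -> R^o} := HB.pack (koszul u v : g -> R^o) kM.
  exact: (riesz k).
pose n u v := sval (cid (ex u v)).
have nE u v w : ip (n u v) w = koszul u v w by exact: svalP (cid (ex u v)) w.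
have bil : bilinear_for *:%R *:%R n.
  split=> v a x y; apply: ip_inj => w; rewrite ipPl !nE /koszul;
    by rewrite !(liePl, liePr, ipPl, ipPr); ring.
pose nM := bilinear_isBilinear.Build _ _ _ _ _ _ n bil.
pose N : {bilinear g -> g -> g} := HB.pack n nM.
have NE u v w : ip (N u v) w = koszul u v w by exact: nE.
exists N; split=> [u v | w u v].
  apply: ip_inj => w; rewrite linearBl /= !NE /koszul.
  rewrite (lieC v u) (lieC u w) (lieC w v) !linearNl /=; lra.
rewrite [ip u _]ipC !NE /koszul (lieC v w) (lieC w u) (lieC u v) !linearNl /=.
lra.
Qed.

Definition levi_civita : {bilinear g -> g -> g} := sval (cid levi_civita_exists).

Lemma levi_civitaP : is_levi_civita levi_civita.
Proof. exact: svalP (cid levi_civita_exists). Qed.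

End LeviCivita.

Section Distributions.
Variables (R : realType) (g : riemLieAlg R).
Implicit Types (V : {vspace g}) (u v w : g).

Definition projV V : g -> g := daddv_pi V (orthov ip V).
Definition projH V : g -> g := daddv_pi (orthov ip V) V.

Lemma orthov_direct V : (V :&: orthov ip V = 0)%VS.
Proof.
apply/eqP; rewrite -subv0; apply/subvP => x; rewrite memv_cap memv0.
move=> /andP[xV /mem_orthovP/(_ x xV) xx]; apply/negP => /negP nz.
by have := neq0_dnorm_gt0 (s := ip) _ nz; rewrite xx ltxx.
Qed.

Definition BV V u v :=
  2^-1 *: projH V (levi_civita g u v + levi_civita g v u).
Definition BH V u v :=
  2^-1 *: projV V (levi_civita g u v + levi_civita g v u).

Definition integrable V := {in V &, forall u v, lie u v \in V}.

Definition conformal_with V w :=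
  {in orthov ip V &, forall u v, BH V u v = ip u v *: w}.
Definition conformal V := exists2 w, w \in V & conformal_with V w.
Definition riemannian V := conformal_with V 0.

(* The trace does not depend on the orthonormal basis in which it is
   computed. *)
Definition minimal V := exists e : seq g,
  [/\ basis_of V e, orthonormal ip e & \sum_(u <- e) BV V u u = 0].
Definition totally_geodesic V := {in V &, forall u v, BV V u v = 0}.

(* The basis {X, Y, Z, A, B} is adapted to V = span{X, Y, Z}. *)
Definition adapted_basis (X Y Z A B : g) :=
  [/\ basis_of fullv [:: X; Y; Z; A; B],
      orthonormal ip [:: X; Y; Z; A; B]
    & exists r : R, projH <<[:: X; Y; Z]>> (lie A B) = r *: A].

Definition sl2_relations (lambda : R) (X Y Z : g) :=
  [/\ lie X Y = (2 * lambda) *: Z,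
      lie Z X = (2 * lambda) *: Y
    & lie Y Z = - (2 / lambda) *: X].

Definition sl2_setting (lambda : R) (X Y Z A B : g) :=
  let V := <<[:: X; Y; Z]>>%VS in
  [/\ \dim {: g} = 5%N, adapted_basis X Y Z A B & sl2_relations lambda X Y Z]
  /\ [/\ integrable V, minimal V & conformal V].

End Distributions.

(* Main.v *)
Require Import Defs.
From HB Require Import structures.
From mathcomp Require Import all_boot all_order all_algebra.
From mathcomp Require Import boolp reals.
From mathcomp Require Import ring lra.

Set Implicit Arguments.
Unset Strict Implicit.
Unset Printing Implicit Defensive.

Import Order.TTheory GRing.Theory Num.Theory.
Local Open Scope ring_scope.

(** Write [V] for the span of [X], [Y], [Z] and [H] for its orthogonal
    complement.  By the Koszul formula, the second fundamental forms [BV] and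
    [BH] are the symmetrized brackets of [ip_BV] and [ip_BH].

    For [BH] this means that conformality constrains, for each [u] in [V], the
    [H]-component of [lie u _] on [H]: its matrix is a scalar plus an
    antisymmetric matrix ([conformal_coeffs]).  Since [V] is a subalgebra, these
    matrices give the action of [V] on the plane [g / V].  Such 2x2 matrices
    commute, as complex multiplications do, so every commutator of elements of
    [V] acts by zero ([conformal_lie_vert]).  But sl2 is its own commutator
    algebra, so all of [V] acts by zero, that is, [V] is an ideal
    ([sl2_ideal]); hence [BH] vanishes and the foliation is Riemannian
    ([ideal_riemannian]).

    Now bracketing with [A] and with [B] are derivations of sl2.  These form a
    3-dimensional space, written down in [sl2_derivation]; this gives
    [x3, x5, z3] and [x4, x6, z4].  The Jacobi identity for [A], [B] and a vector
    of [V] says that the commutator of the two derivations is the derivation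
    given by [lie A B]; as sl2 has trivial center, this determines the vertical
    part of [lie A B] ([sl2_curvature]).

    Finally, the component of [BV X Y] along [A] is
    [- (lambda ^+ 2 + 1) * x3 / 2], and the other three parameters are read off
    in the same way ([geodesic_shear]).  A foliation of the family that is not
    totally geodesic is obtained from [x3 = 1], all other parameters being zero. *)

(** * Calculus with brackets and inner products *)

Section Calculus.
Variables (R : realType) (g : riemLieAlg R).
Implicit Types (u v w : g) (a : R).

Lemma ip0l w : ip 0 w = 0.
Proof. exact: linear0l. Qed.

Lemma ip0r w : ip w 0 = 0.
Proof. exact: linear0r. Qed.

Lemma ipDl u v w : ip (u + v) w = ip u w + ip v w.
Proof. exact: linearDl. Qed.

Lemma ipDr u v w : ip w (u + v) = ip w u + ip w v.
Proof. exact: linearDr. Qed.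

Lemma ipZl a u w : ip (a *: u) w = a * ip u w.
Proof. exact: linearZl_LR. Qed.

Lemma ipZr a u w : ip w (a *: u) = a * ip w u.
Proof. by rewrite ipC ipZl ipC. Qed.

Lemma ipNl u w : ip (- u) w = - ip u w.
Proof. exact: linearNl. Qed.

Lemma lie0l w : lie 0 w = 0.
Proof. exact: linear0l. Qed.

Lemma lie0r w : lie w 0 = 0.
Proof. exact: linear0r. Qed.

Lemma lieDl u v w : lie (u + v) w = lie u w + lie v w.
Proof. exact: linearDl. Qed.

Lemma lieDr u v w : lie w (u + v) = lie w u + lie w v.
Proof. exact: linearDr. Qed.

Lemma lieZl a u w : lie (a *: u) w = a *: lie u w.
Proof. exact: linearZl_LR. Qed.

Lemma lieZr a u w : lie w (a *: u) = a *: lie w u.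
Proof. exact: linearZr_LR. Qed.

Lemma lieNl u w : lie (- u) w = - lie u w.
Proof. exact: linearNl. Qed.

Lemma lieNr u w : lie w (- u) = - lie w u.
Proof. exact: linearNr. Qed.

Definition ipE := (ipDl, ipDr, ipZl, ipZr, ipNl, ip0l, ip0r).
Definition lieE := (lieDl, lieDr, lieZl, lieZr, lieNl, lieNr, lie0l, lie0r).

Lemma ip_eq0 u : ip u u = 0 -> u = 0.
Proof.
move=> uu; apply/eqP/negP => /negP nz.
by have := neq0_dnorm_gt0 (s := ip) _ nz; rewrite uu ltxx.
Qed.

Lemma ip_orthov (V : {vspace g}) u w : u \in orthov ip V -> w \in V -> ip u w = 0.
Proof. by move=> /mem_orthovP; apply. Qed.

(** Bracketing with [w] on the right is a derivation: the form in which the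
    Jacobi identity is used below. *)
Lemma lie_derivation u v w :
  lie (lie u v) w = lie (lie u w) v + lie u (lie v w).
Proof.
have /eqP := lie_jacobi u v w.
rewrite (lieC w (lie u v)) subr_eq0 => /eqP <-.
by rewrite (lieC w u) lieNr (lieC v (lie u w)) opprK addrC.
Qed.

(** In the Koszul formula, the bracket of [u] and [v] cancels on symmetrizing. *)
Lemma levi_civita_sym u v w :
  ip (levi_civita g u v + levi_civita g v u) w
  = ip (lie w u) v + ip (lie w v) u.
Proof.
rewrite ipDl !(levi_civita_koszul (levi_civitaP g)) /koszul.
rewrite (lieC v u) (lieC v w) (lieC u w) !ipE; lra.
Qed.

End Calculus.

(** * The splitting of an orthonormal frame *)

Section Frame.
Variables (R : realType) (g : riemLieAlg R) (X Y Z A B : g).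
Hypothesis full : basis_of fullv [:: X; Y; Z; A; B].
Hypothesis ortho : orthonormal ip [:: X; Y; Z; A; B].
Implicit Types (u v w : g).
Local Notation V := <<[:: X; Y; Z]>>%VS.
Local Notation H := (orthov ip V).

(** A product of equations, so that it can be used as a rewrite rule. *)
Lemma frame_ip :
  ((ip X X = 1) * (ip X Y = 0) * (ip X Z = 0) * (ip X A = 0) * (ip X B = 0) *
   (ip Y X = 0) * (ip Y Y = 1) * (ip Y Z = 0) * (ip Y A = 0) * (ip Y B = 0) *
   (ip Z X = 0) * (ip Z Y = 0) * (ip Z Z = 1) * (ip Z A = 0) * (ip Z B = 0) *
   (ip A X = 0) * (ip A Y = 0) * (ip A Z = 0) * (ip A A = 1) * (ip A B = 0) *
   (ip B X = 0) * (ip B Y = 0) * (ip B Z = 0) * (ip B A = 0) * (ip B B = 1))%type.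
Proof.
have /andP[/and5P[/eqP XX /eqP YY /eqP ZZ /eqP AA /andP[/eqP BB _]]] := ortho.
rewrite /= !andbT => /and4P[/and4P[/eqP XY /eqP XZ /eqP XA /eqP XB]].
move=> /and3P[/eqP YZ /eqP YA /eqP YB] /andP[/eqP ZA /eqP ZB] /eqP AB.
have sym u v : ip u v = 0 -> ip v u = 0 by rewrite ipC.
by do 24?split; first [assumption | exact: sym].
Qed.

Let simps := (mulr0, mulr1, addr0, add0r).

Lemma frame_expand u :
  u = ip u X *: X + ip u Y *: Y + ip u Z *: Z + ip u A *: A + ip u B *: B.
Proof.
have : u \in <<[:: X; Y; Z; A; B]>>%VS by rewrite (span_basis full) memvf.
rewrite !span_cons span_nil addv0.
case/memv_addP=> _ /vlineP[x ->] [v1 + ->].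
case/memv_addP=> _ /vlineP[y ->] [v2 + ->].
case/memv_addP=> _ /vlineP[z ->] [v3 + ->].
case/memv_addP=> _ /vlineP[a ->] [_ /vlineP[b ->] ->].
by rewrite !ipE !frame_ip !simps !addrA.
Qed.

Lemma mem_frame : [/\ X \in V, Y \in V & Z \in V] /\ (A \in H /\ B \in H).
Proof.
have inV x : x \in [:: X; Y; Z] -> x \in V by exact: memv_span.
have inH u : ip X u = 0 -> ip Y u = 0 -> ip Z u = 0 -> u \in H.
  move=> Xu Yu Zu; rewrite mem_orthov_sym; apply/span_subvP => x.
  by rewrite !inE mem_orthov1 => /or3P[] /eqP ->; apply/eqP.
split; first by split; apply: inV; rewrite !inE eqxx ?orbT.
by split; apply: inH; rewrite frame_ip.
Qed.

Lemma vertP u : reflect (ip u A = 0 /\ ip u B = 0) (u \in V).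
Proof.
have [[XV YV ZV] [AH BH]] := mem_frame.
apply: (iffP idP) => [uV | [uA uB]]; first by rewrite ![ip u _]ipC (ip_orthov AH uV) (ip_orthov BH uV).
by rewrite [u]frame_expand uA uB !scale0r !addr0 !memvD ?memvZ.
Qed.

Lemma vert_expand u : u \in V -> u = ip u X *: X + ip u Y *: Y + ip u Z *: Z.
Proof.
by move=> /vertP[uA uB]; rewrite {1}[u]frame_expand uA uB !scale0r !addr0.
Qed.

Lemma proj_add u : projV V u + projH V u = u.
Proof.
apply: (daddv_pi_add (orthov_direct V)).
have [[XV YV ZV] [AH BH]] := mem_frame.
by rewrite [u]frame_expand -addrA memv_add ?memvD ?memvZ.
Qed.

Lemma ip_projV u w : w \in V -> ip (projV V u) w = ip u w.
Proof.
move=> wV; rewrite -{2}[u]proj_add ipDl.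
have /ip_orthov/(_ wV) -> : projH V u \in H by exact: memv_pi.
by rewrite addr0.
Qed.

Lemma ip_projH u w : w \in H -> ip (projH V u) w = ip u w.
Proof.
move=> wH; rewrite -{2}[u]proj_add ipDl [ip (projV V u) w]ipC.
have /(ip_orthov wH) -> : projV V u \in V by exact: memv_pi.
by rewrite add0r.
Qed.

Lemma ip_BV u v w : w \in H ->
  ip (BV V u v) w = 2^-1 * (ip (lie w u) v + ip (lie w v) u).
Proof. by move=> wH; rewrite ipZl ip_projH // levi_civita_sym. Qed.

Lemma ip_BH u v w : w \in V ->
  ip (BH V u v) w = 2^-1 * (ip (lie w u) v + ip (lie w v) u).
Proof. by move=> wV; rewrite ipZl ip_projV // levi_civita_sym. Qed.

Lemma ideal_riemannian :
  (forall u v, u \in V -> lie u v \in V) -> riemannian V.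
Proof.
move=> idl u v uH vH; rewrite scaler0; apply: ip_eq0.
have BHV : BH V u v \in V by rewrite memvZ // memv_pi.
rewrite ip_BH // ![ip (lie _ _) _]ipC.
rewrite (ip_orthov vH (idl _ _ BHV)) (ip_orthov uH (idl _ _ BHV)).
by rewrite addr0 mulr0.
Qed.

(** The trace of [BV] along [h] is the trace on [V] of bracketing with [h]. *)
Lemma minimal_of_trace :
  (forall h, h \in H ->
    ip (lie h X) X + ip (lie h Y) Y + ip (lie h Z) Z = 0) ->
  minimal V.
Proof.
move=> tr; exists [:: X; Y; Z]; split.
- have /basis_free : basis_of fullv ([:: X; Y; Z] ++ [:: A; B]) := full.
  by move/catl_free => free3; rewrite /basis_of free3 eqxx.
- by rewrite /orthonormal /= !frame_ip !eqxx.
rewrite !big_cons big_nil addr0; apply: ip_eq0.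
set s := (X in ip X X).
have sH : s \in H by rewrite !memvD // memvZ // memv_pi.
by rewrite {1}/s !ipDl !(ip_BV _ _ sH); have := tr s sH; lra.
Qed.

(** * Conformality makes sl2 an ideal *)

Lemma conformal_coeffs u : conformal V -> u \in V ->
  ip (lie u A) A = ip (lie u B) B /\ ip (lie u A) B = - ip (lie u B) A.
Proof.
move=> [w wV cw] uV; have [_ [AH BH]] := mem_frame.
have hAA := ip_BH A A uV; have hBB := ip_BH B B uV; have hAB := ip_BH A B uV.
rewrite cw // ipZl !frame_ip in hAA.
rewrite cw // ipZl !frame_ip in hBB.
rewrite cw // ipZl !frame_ip in hAB.
split; lra.
Qed.

(** Integrability makes the action of [u] on [g / V] well defined. *)
Lemma ip_lie_horiz u v w : integrable V -> u \in V -> w \in H ->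
  ip (lie u v) w = ip v A * ip (lie u A) w + ip v B * ip (lie u B) w.
Proof.
move=> intV uV wH; have [[XV YV ZV] _] := mem_frame.
have lieH x : x \in V -> ip (lie u x) w = 0.
  by move=> xV; rewrite ipC (ip_orthov wH (intV _ _ uV xV)).
rewrite {1}[v]frame_expand !lieE !ipE (lieH X XV) (lieH Y YV) (lieH Z ZV).
by rewrite !simps.
Qed.

(** The matrices of [u] and [v] on [g / V] lie in the copy of the complex
    numbers given by [conformal_coeffs], hence they commute. *)
Lemma conformal_lie_vert u v w : integrable V -> conformal V ->
  u \in V -> v \in V -> lie (lie u v) w \in V.
Proof.
move=> intV cV uV vV; have [_ [AH BH]] := mem_frame.
have [uA uB] := conformal_coeffs cV uV; have [vA vB] := conformal_coeffs cV vV.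
apply/vertP; rewrite lie_derivation (lieC (lie u w)) !ipE.
rewrite !(@ip_lie_horiz u (lie v w)) // !(@ip_lie_horiz v (lie u w)) //.
rewrite !(@ip_lie_horiz u w) // !(@ip_lie_horiz v w) // uA uB vA vB.
by split; ring.
Qed.

Variable lambda : R.
Hypothesis lambda_gt0 : 0 < lambda.
Hypothesis sl2 : sl2_relations lambda X Y Z.

Let lambda_neq0 : lambda != 0. Proof. by rewrite gt_eqF. Qed.
Let two_neq0 : 2 != 0 :> R. Proof. by rewrite pnatr_eq0. Qed.
Let two_lambda_neq0 : 2 * lambda != 0. Proof. exact: mulf_neq0. Qed.

(** Each of [X], [Y], [Z] is a multiple of a bracket of the other two. *)
Lemma sl2_ideal : integrable V -> conformal V ->
  forall u w, u \in V -> lie u w \in V.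
Proof.
move=> intV cV u w /vert_expand ->.
have [[XV YV ZV] _] := mem_frame; have [XY ZX YZ] := sl2.
have comm x y z a : a != 0 -> x \in V -> y \in V -> lie x y = a *: z ->
    lie z w \in V.
  move=> a0 xV yV xy; have := conformal_lie_vert w intV cV xV yV.
  by rewrite xy lieZl => /(memvZ a^-1); rewrite scalerA mulVf // scale1r.
rewrite !lieE !memvD // memvZ //.
- by apply: (comm Y Z X _ _ YV ZV YZ); rewrite oppr_eq0 mulf_neq0 ?invr_eq0.
- exact: (comm Z X Y _ _ ZV XV ZX).
- exact: (comm X Y Z _ _ XV YV XY).
Qed.

(** * Derivations of sl2 *)

Lemma sl2_brackets :
  ((lie X Y = (2 * lambda) *: Z) * (lie Y X = - (2 * lambda) *: Z) *
   (lie Z X = (2 * lambda) *: Y) * (lie X Z = - (2 * lambda) *: Y) *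
   (lie Y Z = - (2 / lambda) *: X) * (lie Z Y = (2 / lambda) *: X))%type.
Proof.
have [XY ZX YZ] := sl2.
by rewrite (lieC Y X) (lieC X Z) (lieC Z Y) XY ZX YZ -!scaleNr opprK.
Qed.

(** The nine coefficients of [lie _ E] on [V] are constrained by the coordinates
    of the derivation rule at the three brackets of the frame. *)
Lemma sl2_derivation E : (forall u, u \in V -> lie u E \in V) ->
  exists x y z : R,
    [/\ lie X E = (lambda ^+ 2 * x) *: Y + (lambda ^+ 2 * y) *: Z,
        lie Y E = x *: X + z *: Z
      & lie Z E = y *: X - z *: Y].
Proof.
move=> EV; have [[XV YV ZV] _] := mem_frame; have [XY ZX YZ] := sl2.
have := (vert_expand (EV _ XV), vert_expand (EV _ YV), vert_expand (EV _ ZV)).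
move: (ip (lie X E) X) (ip (lie X E) Y) (ip (lie X E) Z) => a1 a2 a3.
move: (ip (lie Y E) X) (ip (lie Y E) Y) (ip (lie Y E) Z) => b1 b2 b3.
move: (ip (lie Z E) X) (ip (lie Z E) Y) (ip (lie Z E) Z) => c1 c2 c3.
move=> [[eX eY] eZ].
have dXY := lie_derivation X Y E.
rewrite XY eX eY !lieE eZ !sl2_brackets !lie_alt in dXY.
have dZX := lie_derivation Z X E.
rewrite ZX eX eZ !lieE eY !sl2_brackets !lie_alt in dZX.
have dYZ := lie_derivation Y Z E.
rewrite YZ eY eZ !lieE eX !sl2_brackets !lie_alt in dYZ.
have := (congr1 (ip^~ X) dXY, congr1 (ip^~ Y) dXY, congr1 (ip^~ Z) dXY).
rewrite /= !ipE !frame_ip !simps => -[[c1E c2E] c3E].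
have := (congr1 (ip^~ X) dZX, congr1 (ip^~ Y) dZX, congr1 (ip^~ Z) dZX).
rewrite /= !ipE !frame_ip !simps => -[[b1E b2E] b3E].
have := congr1 (ip^~ X) dYZ; rewrite /= !ipE !frame_ip !simps => a1E.
(* The diagonal entries satisfy c3 = a1 + b2, b2 = c3 + a1 and a1 = b2 + c3. *)
have a1_0 : a1 = 0 by apply: (mulfI two_lambda_neq0); lra.
have b2c3 : b2 = c3.
  by apply: (mulfI two_lambda_neq0); rewrite a1_0 in b2E *; lra.
have c3_0 : c3 = 0.
  apply: (mulfI (mulf_neq0 two_neq0 (invr_neq0 lambda_neq0))).
  by rewrite b2c3 a1_0 in a1E *; lra.
have a2b1 : a2 = lambda ^+ 2 * b1.
  have -> : a2 = lambda * (a2 * (2 / lambda)) / 2 by field.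
  by rewrite -b1E; field.
have a3c1 : a3 = lambda ^+ 2 * c1.
  have -> : a3 = lambda * (a3 * (2 / lambda)) / 2 by field.
  by rewrite -c1E; field.
have c2b3 : c2 = - b3 by apply: (mulfI two_lambda_neq0); lra.
exists b1, c1, b3; split.
- by rewrite eX a1_0 a2b1 a3c1 scale0r add0r.
- by rewrite eY b2c3 c3_0 scale0r addr0.
- by rewrite eZ c3_0 c2b3 scale0r addr0 scaleNr.
Qed.

(** The Jacobi identities for [X, A, B] and [Y, A, B] suffice: no nonzero vector
    of [V] commutes with both [X] and [Y]. *)
Lemma sl2_curvature r t1 t2 t3 x3 x4 x5 x6 z3 z4 :
  lie A B = r *: A + t1 *: X + t2 *: Y + t3 *: Z ->
  [/\ lie X A = (lambda ^+ 2 * x3) *: Y + (lambda ^+ 2 * x5) *: Z,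
      lie Y A = x3 *: X + z3 *: Z
    & lie Z A = x5 *: X - z3 *: Y] ->
  [/\ lie X B = (lambda ^+ 2 * x4) *: Y + (lambda ^+ 2 * x6) *: Z,
      lie Y B = x4 *: X + z4 *: Z
    & lie Z B = x6 *: X - z4 *: Y] ->
  [/\ t1 = 2^-1 * (r * z3 / lambda - lambda * (x3 * x6 - x4 * x5)),
      t2 = 2^-1 * (- (lambda * (r * x5 - x3 * z4 + x4 * z3)))
    & t3 = 2^-1 * (lambda * (r * x3 + z4 * x5 - z3 * x6))].
Proof.
move=> AB [XA YA ZA] [XB YB ZB].
have dX := lie_derivation X A B.
rewrite XA XB AB !lieE YB ZB YA ZA XA !sl2_brackets !lie_alt in dX.
have dY := lie_derivation Y A B.
rewrite YA YB AB !lieE XB ZB XA ZA YA !sl2_brackets !lie_alt in dY.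
have := (congr1 (ip^~ Y) dX, congr1 (ip^~ Z) dX, congr1 (ip^~ Z) dY).
rewrite /= !ipE !frame_ip !simps => -[[t3E t2E] t1E].
split; apply: (mulfI two_lambda_neq0); [|lra|lra].
transitivity (r * z3 - lambda ^+ 2 * (x3 * x6 - x4 * x5)); last by field.
lra.
Qed.

(** * Total geodesy *)

(** The components of [BV X Y] and [BV X Z] along [h] are [x] and [y] times
    [- (lambda ^+ 2 + 1) / 2]. *)
Lemma geodesic_shear h x y z : h \in H -> totally_geodesic V ->
  lie X h = (lambda ^+ 2 * x) *: Y + (lambda ^+ 2 * y) *: Z ->
  lie Y h = x *: X + z *: Z -> lie Z h = y *: X - z *: Y ->
  x = 0 /\ y = 0.
Proof.
move=> hH tg Xh Yh Zh; have [[XV YV ZV] _] := mem_frame.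
have := (ip_BV X Y hH, ip_BV X Z hH); rewrite !tg // !(lieC h) Xh Yh Zh.
rewrite !ipE !frame_ip !simps => -[eXY eXZ].
have l1 : lambda ^+ 2 + 1 != 0 by rewrite gt_eqF // ltr_wpDl ?sqr_ge0.
by split; apply: (mulfI l1); lra.
Qed.

End Frame.

(** * A foliation that is not totally geodesic *)

(** Stated for an abstract space: on tuples, closure of a subspace under sums is
    hard to apply, because sums of tuples are convertible to tuples. *)
Lemma mem_span5 (K : fieldType) (vT : vectType K) (X Y Z A B : vT)
    (x y z a b : K) :
  x *: X + y *: Y + z *: Z + a *: A + b *: B \in <<[:: X; Y; Z; A; B]>>%VS.
Proof.
have mem v : v \in [:: X; Y; Z; A; B] -> v \in <<[:: X; Y; Z; A; B]>>%VS.
  exact: memv_span.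
by rewrite !memvD // memvZ // mem // !inE eqxx ?orbT.
Qed.

Section Shear.
Variables (R : realType) (lambda : R).
Hypothesis lambda_gt0 : 0 < lambda.
Local Notation T := (R^o * R^o * R^o * R^o * R^o)%type.

Let lambda_neq0 : lambda != 0. Proof. by rewrite gt_eqF. Qed.

(** The member [x3 = 1] of the family, all other parameters being zero: the
    orthogonal product of a line with the semidirect product of sl2 by the
    derivation mapping [X] to [lambda ^+ 2 *: Y] and [Y] to [X].  The abstraction
    gives the coordinates the type [R], so that the ring operations are those of
    [R] rather than of the regular module. *)
Definition shear_lie (u v : T) : T :=
  (fun x y z a b x' y' z' a' b' : R =>
    (- (2 / lambda) * (y * z' - z * y') + (y * a' - a * y'),
     2 * lambda * (z * x' - x * z') + lambda ^+ 2 * (x * a' - a * x'),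
     2 * lambda * (x * y' - y * x'), 0, 0) : T)
  u.1.1.1.1 u.1.1.1.2 u.1.1.2 u.1.2 u.2 v.1.1.1.1 v.1.1.1.2 v.1.1.2 v.1.2 v.2.

Definition shear_ip (u v : T) : R :=
  (fun x y z a b x' y' z' a' b' : R =>
    x * x' + y * y' + z * z' + a * a' + b * b')
  u.1.1.1.1 u.1.1.1.2 u.1.1.2 u.1.2 u.2 v.1.1.1.1 v.1.1.1.2 v.1.1.2 v.1.2 v.2.

Lemma coords_rect (P : T -> Prop) :
  (forall x y z a b : R, P (x, y, z, a, b)) -> forall u, P u.
Proof. by move=> Pu [[[[x y] z] a] b]; apply: Pu. Qed.

Lemma coords_add (x y z a b x' y' z' a' b' : R) :
  (x, y, z, a, b) + (x', y', z', a', b')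
  = (x + x', y + y', z + z', a + a', b + b') :> T.
Proof. by []. Qed.

Lemma coords_scale (c x y z a b : R) :
  c *: ((x, y, z, a, b) : T) = (c * x, c * y, c * z, c * a, c * b).
Proof. by []. Qed.

Lemma coords_eq (x y z a b x' y' z' a' b' : R) :
  x = x' -> y = y' -> z = z' -> a = a' -> b = b' ->
  (x, y, z, a, b) = (x', y', z', a', b') :> T.
Proof. by do 5 move->. Qed.

Lemma shear_lieE (x y z a b x' y' z' a' b' : R) :
  shear_lie (x, y, z, a, b) (x', y', z', a', b') =
  (- (2 / lambda) * (y * z' - z * y') + (y * a' - a * y'),
   2 * lambda * (z * x' - x * z') + lambda ^+ 2 * (x * a' - a * x'),
   2 * lambda * (x * y' - y * x'), 0, 0).
Proof. by []. Qed.

Lemma shear_lie_bilinear : bilinear_for *:%R *:%R shear_lie.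
Proof.
split=> w c u v; elim/coords_rect: u => x y z a b;
  elim/coords_rect: v => x1 y1 z1 a1 b1; elim/coords_rect: w => x2 y2 z2 a2 b2;
  rewrite coords_scale coords_add /shear_lie /= coords_scale coords_add;
  by apply: coords_eq; ring.
Qed.

Lemma shear_ip_bilinear : bilinear_for *%R (@idfun R \; *%R) shear_ip.
Proof.
split=> w c u v; elim/coords_rect: u => x y z a b;
  elim/coords_rect: v => x1 y1 z1 a1 b1; elim/coords_rect: w => x2 y2 z2 a2 b2;
  by rewrite coords_scale coords_add /shear_ip /=; ring.
Qed.

Lemma shear_ip_sym u v : shear_ip u v = (-1) ^+ false * idfun (shear_ip v u).
Proof.
elim/coords_rect: u => x y z a b; elim/coords_rect: v => x1 y1 z1 a1 b1.
by rewrite expr0 mul1r /shear_ip /=; ring.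
Qed.

Lemma shear_ip_pos u : u != 0 -> 0 < shear_ip u u.
Proof.
elim/coords_rect: u => x y z a b nz.
rewrite /shear_ip /= -!expr2 lt_neqAle eq_sym !addr_ge0 ?sqr_ge0 // andbT.
apply: contra nz; rewrite !paddr_eq0 ?addr_ge0 ?sqr_ge0 // !sqrf_eq0.
by move=> /andP[/andP[/andP[/andP[/eqP-> /eqP->] /eqP->] /eqP->] /eqP->].
Qed.

Lemma shear_lie_alt u : shear_lie u u = 0.
Proof.
elim/coords_rect: u => x y z a b.
by rewrite shear_lieE; apply: coords_eq; ring.
Qed.

Lemma shear_lie_jacobi u v w :
  shear_lie u (shear_lie v w) + shear_lie v (shear_lie w u)
  + shear_lie w (shear_lie u v) = 0.
Proof.
elim/coords_rect: u => x y z a b; elim/coords_rect: v => x1 y1 z1 a1 b1.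
elim/coords_rect: w => x2 y2 z2 a2 b2.
rewrite !shear_lieE !coords_add; apply: coords_eq; rewrite /= ?addr0 //;
  by field.
Qed.

HB.instance Definition _ :=
  bilinear_isBilinear.Build _ _ _ _ _ _ shear_lie shear_lie_bilinear.
HB.instance Definition _ :=
  bilinear_isBilinear.Build _ _ _ _ _ _ shear_ip shear_ip_bilinear.
HB.instance Definition _ :=
  isHermitianSesquilinear.Build _ _ _ _ shear_ip shear_ip_sym.
HB.instance Definition _ := isDotProduct.Build _ _ shear_ip shear_ip_pos.

Definition shear_alg : riemLieAlg R :=
  @RiemLieAlg R T shear_lie shear_ip shear_lie_alt shear_lie_jacobi.

Let X : shear_alg := ((1, 0, 0, 0, 0) : T).
Let Y : shear_alg := ((0, 1, 0, 0, 0) : T).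
Let Z : shear_alg := ((0, 0, 1, 0, 0) : T).
Let A : shear_alg := ((0, 0, 0, 1, 0) : T).
Let B : shear_alg := ((0, 0, 0, 0, 1) : T).
Local Notation V := <<[:: X; Y; Z]>>%VS.

Lemma shear_dim : \dim {: shear_alg} = 5%N.
Proof. by rewrite dimvf. Qed.

Lemma shear_orthonormal : orthonormal ip [:: X; Y; Z; A; B].
Proof.
apply/andP; split; rewrite /= /shear_ip /=;
  by rewrite !(mulr0, mul0r, mulr1, addr0, add0r, eqxx).
Qed.

Lemma shear_basis : basis_of fullv [:: X; Y; Z; A; B].
Proof.
rewrite basisEdim shear_dim leqnn andbT; apply/subvP => u _.
elim/coords_rect: u => x y z a b.
have -> : ((x, y, z, a, b) : shear_alg)
    = x *: X + y *: Y + z *: Z + a *: A + b *: B.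
  rewrite !coords_scale !coords_add.
  by apply: coords_eq; rewrite /= !(mulr0, mulr1, addr0, add0r).
exact: mem_span5.
Qed.

Lemma shear_ideal (u v : shear_alg) : lie u v \in V.
Proof.
apply/(vertP shear_basis shear_orthonormal).
suff : shear_ip (shear_lie u v) A = 0 /\ shear_ip (shear_lie u v) B = 0 by [].
elim/coords_rect: u => x y z a b; elim/coords_rect: v => x1 y1 z1 a1 b1.
by rewrite shear_lieE /shear_ip /=; split; ring.
Qed.

(** The derivation defining the bracket has zero diagonal entries on [V]. *)
Lemma shear_minimal : minimal V.
Proof.
apply: (minimal_of_trace shear_basis shear_orthonormal) => h _.
suff : shear_ip (shear_lie h X) X + shear_ip (shear_lie h Y) Y
    + shear_ip (shear_lie h Z) Z = 0 by [].
elim/coords_rect: h => x y z a b.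
by rewrite !shear_lieE /shear_ip /=; ring.
Qed.

Lemma shear_alg_lieE (x y z a b x' y' z' a' b' : R) :
  lie ((x, y, z, a, b) : shear_alg) ((x', y', z', a', b') : shear_alg) =
  (- (2 / lambda) * (y * z' - z * y') + (y * a' - a * y'),
   2 * lambda * (z * x' - x * z') + lambda ^+ 2 * (x * a' - a * x'),
   2 * lambda * (x * y' - y * x'), 0, 0).
Proof. exact: shear_lieE. Qed.

Lemma shear_sl2_relations : sl2_relations lambda X Y Z.
Proof.
by split; rewrite shear_alg_lieE coords_scale; apply: coords_eq; ring.
Qed.

Lemma shear_sl2_setting : sl2_setting lambda X Y Z A B.
Proof.
split; split.
- exact: shear_dim.
- split; [exact: shear_basis|exact: shear_orthonormal|exists 0].
  have -> : lie A B = 0 by rewrite shear_alg_lieE; apply: coords_eq; ring.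
  by rewrite /projH linear0 scale0r.
- exact: shear_sl2_relations.
- by move=> u v _ _; apply: shear_ideal.
- exact: shear_minimal.
- exists 0; first exact: mem0v.
  apply: (ideal_riemannian shear_basis shear_orthonormal) => u v _.
  exact: shear_ideal.
Qed.

Lemma shear_not_totally_geodesic : ~ totally_geodesic V.
Proof.
have [_ [AH _]] := mem_frame shear_orthonormal => tg.
have XA : lie X A = (lambda ^+ 2 * 1) *: Y + (lambda ^+ 2 * 0) *: Z.
  rewrite shear_alg_lieE !coords_scale coords_add.
  by apply: coords_eq; rewrite /=; ring.
have YA : lie Y A = 1 *: X + 0 *: Z.
  rewrite shear_alg_lieE !coords_scale coords_add.
  by apply: coords_eq; rewrite /=; ring.
have ZA : lie Z A = 0 *: X - 0 *: Y.
  by rewrite shear_alg_lieE !scale0r subr0; apply: coords_eq; rewrite /=; ring.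
have [/eqP] := geodesic_shear shear_basis shear_orthonormal AH tg XA YA ZA.
by rewrite oner_eq0.
Qed.

End Shear.

(** * The classification *)

(* The structure constants with x3 = x4 = x5 = x6 = 0 (for instance the
   orthogonal product of sl2 with a plane) give a totally geodesic foliation for
   every lambda. So the last claim is stated as: within the family of the first
   part, total geodesy fails outside this degenerate locus, and for no lambda
   does the whole family consist of totally geodesic foliations. *)
Theorem theorem5p1 (R : realType) (lambda : R) (lambda_gt0 : 0 < lambda) :
  (forall (g : riemLieAlg R) (X Y Z A B : g),
    sl2_setting lambda X Y Z A B ->
    exists r x3 x4 x5 x6 z3 z4 theta1 theta2 theta3 : R,
    [/\ [/\ lie X Y = (2 * lambda) *: Z,
            lie Z X = (2 * lambda) *: Y
          & lie Y Z = - (2 / lambda) *: X],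
        [/\ lie X A = (lambda ^+ 2 * x3) *: Y + (lambda ^+ 2 * x5) *: Z
          & lie X B = (lambda ^+ 2 * x4) *: Y + (lambda ^+ 2 * x6) *: Z] /\
        [/\ lie Y A = x3 *: X + z3 *: Z,
            lie Y B = x4 *: X + z4 *: Z,
            lie Z A = x5 *: X - z3 *: Y
          & lie Z B = x6 *: X - z4 *: Y],
        lie A B = r *: A + theta1 *: X + theta2 *: Y + theta3 *: Z,
        [/\ theta1 = 2^-1 * (r * z3 / lambda - lambda * (x3 * x6 - x4 * x5)),
            theta2 = 2^-1 * (- (lambda * (r * x5 - x3 * z4 + x4 * z3)))
          & theta3 = 2^-1 * (lambda * (r * x3 + z4 * x5 - z3 * x6))]
      & riemannian <<[:: X; Y; Z]>> /\
        ([|| x3 != 0, x4 != 0, x5 != 0 | x6 != 0] ->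
         ~ totally_geodesic <<[:: X; Y; Z]>>)]) /\
  (exists (g : riemLieAlg R) (X Y Z A B : g),
    sl2_setting lambda X Y Z A B /\ ~ totally_geodesic <<[:: X; Y; Z]>>).
Proof.
split; last first.
  exists (shear_alg lambda_gt0).
  do 5 eexists; split; first exact: shear_sl2_setting.
  exact: shear_not_totally_geodesic.
move=> g X Y Z A B [[_ [full ortho [r rA]] sl2] [intV _ confV]].
have idl := sl2_ideal full ortho lambda_gt0 sl2 intV confV.
have [_ [AH BH]] := mem_frame ortho.
have [x3 [x5 [z3 eA]]] := sl2_derivation full ortho lambda_gt0 sl2 (idl^~ A).
have [x4 [x6 [z4 eB]]] := sl2_derivation full ortho lambda_gt0 sl2 (idl^~ B).
have AB_A : ip (lie A B) A = r.
  by rewrite -(ip_projH full ortho) // rA ipZl (frame_ip ortho) mulr1.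
have AB_B : ip (lie A B) B = 0.
  by rewrite -(ip_projH full ortho) // rA ipZl (frame_ip ortho) mulr0.
have AB := frame_expand full ortho (lie A B).
move: AB; rewrite AB_A AB_B scale0r addr0 addrC !addrA.
move: (ip (lie A B) X) (ip (lie A B) Y) (ip (lie A B) Z) => t1 t2 t3 AB.
exists r, x3, x4, x5, x6, z3, z4, t1, t2, t3.
have [XA YA ZA] := eA; have [XB YB ZB] := eB.
split=> //; first exact: (sl2_curvature ortho lambda_gt0 sl2 AB eA eB).
split=> [|nz tg]; first exact: (ideal_riemannian full ortho idl).
have [x30 x50] := geodesic_shear full ortho AH tg XA YA ZA.
have [x40 x60] := geodesic_shear full ortho BH tg XB YB ZB.
by move: nz; rewrite x30 x40 x50 x60 eqxx.
Qed.
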